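(* Let $q\in(0,1)$ and $\alpha>-1$. The moments $\tilde M_n^{(\alpha)}$ associated with the modified $q$-Laguerre polynomials take the values $$\tilde M_0^{(\alpha)}=1\quad\text{and}\quad\tilde M_n^{(\alpha)}=q^{-\alpha n-(n+1)n/2}\,\frac{(q^{\alpha+1};q)_n}{r_0^{(\alpha)}}\quad\text{for }n\ge1.$$
   Context: Fix $q\in(0,1)$ and $\alpha>-1$. $(a;q)_n=\prod_{k=0}^{n-1}(1-aq^k)$ for $n\in\mathbb{N}_0\cup\{\infty\}$. Put $$\gamma(u,v;q)=\frac{(q^u;q)_\infty}{(q^{u+v};q)_\infty},\qquad r_n^{(\alpha)}=\frac{1-\gamma(n+1,\alpha+1;q)}{1-\gamma(n,\alpha+1;q)},\quad n\ge0$$ (note $\gamma(0,\alpha+1;q)=0$). For $\beta>-1$ the monic $q$-Laguerre polynomials are $$p_n^{(\beta)}(x;q)=(-1)^nq^{-n(n+\beta)}(q^{\beta+1};q)_n\sum_{k=0}^n\frac{(q^{-n};q)_k}{(q^{\beta+1};q)_k(q;q)_k}\,q^{k(k-1)/2}(q^{n+\beta+1}x)^k .$$ The monic modified $q$-Laguerre polynomials are $$\tilde p_n^{(\alpha)}(x;q)=r_n^{(\alpha)}p_n^{(\alpha)}(x;q)+\big(1-r_n^{(\alpha)}\big)p_n^{(\alpha+1)}(x;q),\qquad n\ge0;$$ they form a monic orthogonal polynomial sequence. The associated moment functional $\tilde\Lambda^{(\alpha)}$ is the linear functional on polynomials with $\tilde\Lambda^{(\alpha)}(1)=1$ and $\tilde\Lambda^{(\alpha)}(\tilde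 p_m^{(\alpha)}\tilde p_n^{(\alpha)})=0$ for $m\ne n$, and $\tilde M_n^{(\alpha)}=\tilde\Lambda^{(\alpha)}(x^n)$. *)

(* Defs.v *)
From HB Require Import structures.
From mathcomp Require Import all_boot all_order all_algebra.
From mathcomp Require Import all_classical all_reals all_analysis.

Set Implicit Arguments.
Unset Strict Implicit.
Unset Printing Implicit Defensive.

Import Order.TTheory GRing.Theory Num.Theory.
Import numFieldNormedType.Exports.

Local Open Scope ring_scope.

Section QLaguerre.
Context {R : realType}.
Implicit Types (a q u v alpha beta : R) (n : nat).

Definition qpoch a q n : R := \prod_(k < n) (1 - a * q ^+ k).

(* The limit of the partial products exists for |q| < 1. *)
Definition qpoch_inf a q : R := limn (qpoch a q).

(* Real powers of q are written with powR; q is always positive in use. *)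
Definition qgamma u v q : R :=
  qpoch_inf (q `^ u) q / qpoch_inf (q `^ (u + v)) q.

Definition rcoef q alpha n : R :=
  (1 - qgamma n.+1%:R (alpha + 1) q) / (1 - qgamma n%:R (alpha + 1) q).

Definition qLaguerre q beta n : {poly R} :=
  ((-1) ^+ n * q `^ (- (n%:R * (n%:R + beta))) * qpoch (q `^ (beta + 1)) q n) *:
  \sum_(k < n.+1)
    (qpoch (q `^ (- n%:R)) q k / (qpoch (q `^ (beta + 1)) q k * qpoch q q k)
     * q `^ (k%:R * (k%:R - 1) / 2)) *:
    (q `^ (n%:R + beta + 1) *: 'X) ^+ k.

Definition modified_qLaguerre q alpha n : {poly R} :=
  rcoef q alpha n *: qLaguerre q alpha n
  + (1 - rcoef q alpha n) *: qLaguerre q (alpha + 1) n.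

(* For a sequence P with deg (P n) = n, at most one linear functional
   satisfies this predicate. *)
Definition is_moment_functional (P : nat -> {poly R})
    (Lambda : {scalar {poly R}}) : Prop :=
  Lambda 1 = 1 /\ forall m n : nat, m <> n -> Lambda (P m * P n) = 0.

Definition moment (Lambda : {scalar {poly R}}) n : R := Lambda 'X^n.

End QLaguerre.

(* Main.v *)
(* With a = q^(alpha+1) and M_k = a^(-k) q^(-k(k-1)/2) (a;q)_k, let L be the
   functional x^k |-> M_k. It annihilates the q-Laguerre polynomials p_n of
   parameter alpha (n >= 1), while the q-Chu-Vandermonde sum gives
   L(p'_n) = p'_n(0) (q;q)_n / (aq;q)_n for the polynomials p'_n of parameter
   alpha + 1. Since gamma(n+1) (1 - q^n) = gamma(n) (1 - a q^n), the functional
   L + (r_0 - 1) ev_0 therefore kills r_n p_n + (1 - r_n) p'_n for n >= 1.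
   These polynomials being monic, their common annihilator is determined up to
   a scalar, so r_0 Lambda = L + (r_0 - 1) ev_0. *)
Require Import Defs.
From HB Require Import structures.
From mathcomp Require Import all_boot all_order all_algebra.
From mathcomp Require Import all_classical all_reals all_analysis.
From mathcomp Require Import ring lra zify.

Set Implicit Arguments.
Unset Strict Implicit.
Unset Printing Implicit Defensive.

Import Order.TTheory GRing.Theory Num.Theory.
Import numFieldNormedType.Exports.

Local Open Scope ring_scope.

(** * Finite and infinite [q]-Pochhammer symbols: splitting, convergence, positivity,
    monotonicity *)

Section QPochhammer.
Context {R : realType} (q : R).
Hypotheses (hq0 : 0 < q) (hq1 : q < 1).
Implicit Types (x y : R) (n k : nat).

Lemma qpoch0 x : qpoch x q 0 = 1.
Proof. by rewrite /qpoch big_ord0. Qed.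

Lemma qpochS x n : qpoch x q n.+1 = qpoch x q n * (1 - x * q ^+ n).
Proof. by rewrite /qpoch big_ord_recr. Qed.

Lemma qpochSl x n : qpoch x q n.+1 = (1 - x) * qpoch (x * q) q n.
Proof.
rewrite /qpoch big_ord_recl expr0 mulr1; congr (_ * _).
by apply: eq_bigr => i _; rewrite exprS mulrA.
Qed.

Lemma qpochD x m n : qpoch x q (m + n) = qpoch x q m * qpoch (x * q ^+ m) q n.
Proof.
rewrite /qpoch big_split_ord /=; congr (_ * _).
by apply: eq_bigr => i _; rewrite exprD mulrA.
Qed.

Lemma mulr_expr_lt1 x n : 0 <= x < 1 -> 0 <= x * q ^+ n < 1.
Proof.
case/andP=> x0 x1; have qn0 : 0 <= q ^+ n by rewrite exprn_ge0 // ltW.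
have qn1 : q ^+ n <= 1 by rewrite exprn_ile1 // ltW.
by rewrite mulr_ge0 //=; apply: le_lt_trans x1; rewrite ler_piMr.
Qed.

Lemma mulr_expr_le1 x n : 0 <= x <= 1 -> 0 <= x * q ^+ n <= 1.
Proof.
case/andP=> x0 x1; have qn0 : 0 <= q ^+ n by rewrite exprn_ge0 // ltW.
have qn1 : q ^+ n <= 1 by rewrite exprn_ile1 // ltW.
by rewrite mulr_ge0 //=; apply: le_trans x1; rewrite ler_piMr.
Qed.

Lemma one_sub_neq0 x n : 0 <= x < 1 -> 1 - x * q ^+ n != 0.
Proof. by move=> /(mulr_expr_lt1 n)/andP[_ h]; rewrite subr_eq0 gt_eqF. Qed.

Lemma qpoch_gt0 x n : 0 <= x < 1 -> 0 < qpoch x q n.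
Proof.
by move=> hx; apply: prodr_gt0 => i _; have /andP[_ h] := mulr_expr_lt1 i hx;
  rewrite subr_gt0.
Qed.

Lemma qpoch_ge0 x n : 0 <= x <= 1 -> 0 <= qpoch x q n.
Proof.
by move=> hx; apply: prodr_ge0 => i _; have /andP[_ h] := mulr_expr_le1 i hx;
  rewrite subr_ge0.
Qed.

(** The partial products decrease and stay nonnegative. The endpoint [x = 1] is allowed because
    gamma(0) involves the argument [q ^+ 0]. *)
Lemma cvg_qpoch x : 0 <= x <= 1 -> cvgn (qpoch x q).
Proof.
move=> hx; apply: nonincreasing_is_cvgn; last first.
  by exists 0 => _ [n _ <-]; apply: qpoch_ge0.
apply/nonincreasing_seqP => n; rewrite qpochS ler_piMr ?qpoch_ge0 //.
by have /andP[h _] := mulr_expr_le1 n hx; rewrite gerBl.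
Qed.

Lemma qpoch_infD x n : 0 <= x <= 1 ->
  qpoch_inf x q = qpoch x q n * qpoch_inf (x * q ^+ n) q.
Proof.
move=> hx; have hc := cvg_qpoch (mulr_expr_le1 n hx).
apply/cvg_lim => //.
rewrite -(cvg_shiftn n).
have -> : (fun k => qpoch x q (k + n)) =
          (fun k => qpoch x q n * qpoch (x * q ^+ n) q k).
  by apply/funext => k; rewrite addnC qpochD.
exact: cvgMr.
Qed.

(** Weierstrass product inequality: a product of factors 1 - t_k with t_k in [0, 1] is at least 1
    minus the sum of the t_k, here a geometric sum. *)
Lemma qpoch_ge1B x n : 0 <= x <= 1 -> 1 - x / (1 - q) <= qpoch x q n.
Proof.
move=> hx; have q1 : 0 < 1 - q by rewrite subr_gt0.
(* The induction needs the exact partial geometric sum; the uniform bound is not inductive. *)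
suff : 1 - x * (1 - q ^+ n) / (1 - q) <= qpoch x q n.
  apply: le_trans; rewrite lerD2l lerN2 ler_pM2r ?invr_gt0 //.
  case/andP: hx => x0 _; rewrite ler_piMr // gerBl exprn_ge0 //; exact: ltW.
elim: n => [|n IH]; first by rewrite qpoch0 expr0 subrr mulr0 mul0r subr0.
have -> : 1 - x * (1 - q ^+ n.+1) / (1 - q) =
          1 - x * (1 - q ^+ n) / (1 - q) - x * q ^+ n.
  by rewrite exprS; field; rewrite gt_eqF.
have p1 : qpoch x q n <= 1.
  apply: prodr_ile1 => i _; have /andP[h1 h2] := mulr_expr_le1 i hx.
  by rewrite subr_ge0 h2 gerBl.
have /andP[h1 h2] := mulr_expr_le1 n hx.
rewrite qpochS; nra.
Qed.

Lemma qpoch_inf_gt0 x : 0 <= x < 1 -> 0 < qpoch_inf x q.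
Proof.
move=> /[dup] hx' /andP[x0 x1]; have hx : 0 <= x <= 1 by rewrite x0 ltW.
have q1 : 0 < 1 - q by rewrite subr_gt0.
(* The bound of [qpoch_ge1B] may be negative at [x], so [N] factors are split off to make it
   positive on the tail. *)
have [N hN] : exists N, q ^+ N < (1 - q).
  have q1' : `|q| < 1 by rewrite ger0_norm // ltW.
  have /cvgrPdist_lt hc := cvg_expr q1'.
  have [N _ /(_ N (leqnn N))/=] := hc _ q1.
  by rewrite sub0r normrN ger0_norm ?exprn_ge0 ?(ltW hq0) //; exists N.
rewrite (qpoch_infD N hx) mulr_gt0 ?qpoch_gt0 //.
apply: (@lt_le_trans _ _ (1 - (x * q ^+ N) / (1 - q))).
  rewrite subr_gt0 ltr_pdivrMr // mul1r; apply: le_lt_trans hN.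
  by rewrite ler_piMl ?exprn_ge0 // ltW.
apply: limr_ge; first exact/cvg_qpoch/mulr_expr_le1.
by near=> n; exact/qpoch_ge1B/mulr_expr_le1.
Unshelve. all: by end_near.
Qed.

Lemma le_qpoch_inf x y : 0 <= x -> x <= y -> y <= 1 ->
  qpoch_inf y q <= qpoch_inf x q.
Proof.
move=> x0 xy y1; have hx : 0 <= x <= 1 by rewrite x0 (le_trans xy).
have hy : 0 <= y <= 1 by rewrite (le_trans x0).
apply: ler_lim; [exact: cvg_qpoch|exact: cvg_qpoch|].
near=> n; apply: ler_prod => i _; have /andP[_ h] := mulr_expr_le1 i hy.
by rewrite subr_ge0 h lerD2l lerN2 ler_wpM2r // exprn_ge0 // ltW.
Unshelve. all: by end_near.
Qed.

Lemma lt_qpoch_inf x y : 0 <= x -> x < y -> y <= 1 ->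
  qpoch_inf y q < qpoch_inf x q.
Proof.
move=> x0 xy y1; have hx : 0 <= x <= 1 by rewrite x0 (le_trans (ltW xy)).
have hy : 0 <= y <= 1 by rewrite y1 (le_trans x0) // ltW.
have hx' : 0 <= x < 1 by rewrite x0 (lt_le_trans xy).
(* Limits keep only weak inequalities; strictness comes from the first factor. *)
rewrite (qpoch_infD 1 hx) (qpoch_infD 1 hy) !qpochS !qpoch0 !mul1r !mulr1.
have hpos := qpoch_inf_gt0 (mulr_expr_lt1 1 hx').
apply: (@le_lt_trans _ _ ((1 - y) * qpoch_inf (x * q ^+ 1) q)); last first.
  by rewrite ltr_pM2r // ltrD2l ltrN2.
apply: ler_wpM2l; first by rewrite subr_ge0.
have q0 := ltW hq0.
apply: le_qpoch_inf; last by have /andP[] := mulr_expr_le1 1 hy.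
  by rewrite mulr_ge0.
by rewrite ler_wpM2r // ltW.
Qed.

End QPochhammer.

(* In terms of Gaussian binomials this is [(-1)^k q^(k(k-1)/2) [n choose k]_q]. *)
Definition qbin_alt {R : realType} (q : R) n k : R :=
  qpoch (q ^- n) q k * q ^+ (n * k) / qpoch q q k.

(** * Pascal rule and summation formulas for the signed Gaussian binomials *)

Section AlternatingGaussianBinomials.
Context {R : realType} (q : R).
Hypotheses (hq0 : 0 < q) (hq1 : q < 1).
Implicit Types (x : R) (n k : nat).

Let q_itv : 0 <= q < 1. Proof. by rewrite hq1 ltW. Qed.

Lemma qbin_alt0 n : qbin_alt q n 0 = 1.
Proof. by rewrite /qbin_alt !qpoch0 muln0 expr0 mulr1 divr1. Qed.

Lemma qbin_alt_gt n : qbin_alt q n n.+1 = 0.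
Proof.
by rewrite /qbin_alt qpochS mulVf ?subrr ?mulr0 ?mul0r // expf_neq0 // gt_eqF.
Qed.

(** The [q]-Pascal rule. The weight q^(k(k-1)/2) absorbs the usual factor q^(n-k), leaving [q ^+ n],
    which is independent of [k]. *)
Lemma qbin_altS n k :
  qbin_alt q n.+1 k.+1 = qbin_alt q n k.+1 - q ^+ n * qbin_alt q n k.
Proof.
have qn0 m : q ^+ m != 0 by rewrite expf_neq0 // gt_eqF.
have q0 : q != 0 by rewrite gt_eqF.
have h1 : qpoch q q k != 0 by rewrite gt_eqF // qpoch_gt0.
have h2 : 1 - q * q ^+ k != 0 by apply: one_sub_neq0.
rewrite /qbin_alt qpochSl !qpochS.
have -> : q ^- n.+1 * q = q ^- n by rewrite exprS; field; rewrite q0 qn0.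
have -> : (n.+1 * k.+1 = n * k + n + k + 1)%N by lia.
have -> : (n * k.+1 = n * k + n)%N by lia.
rewrite !exprD expr1 exprS; field.
by rewrite q0 h1 h2 qn0.
Qed.

Lemma qbin_altnn n : qbin_alt q n n = (-1) ^+ n * q ^+ 'C(n, 2).
Proof.
elim: n => [|n IH]; first by rewrite qbin_alt0 expr0 mulr1.
by rewrite qbin_altS qbin_alt_gt IH binS bin1 exprD exprS; ring.
Qed.

(** Summed Pascal rule: lowers [n] at the cost of a twisted difference of [f]. Both sums below
    follow from it by induction. *)
Lemma sum_qbin_altS n (f : nat -> R) :
  \sum_(k < n.+2) qbin_alt q n.+1 k * f k =
  \sum_(k < n.+1) qbin_alt q n k * (f k - q ^+ n * f k.+1).
Proof.
rewrite big_ord_recl qbin_alt0.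
have -> : \sum_(i < n.+1) qbin_alt q n.+1 (lift ord0 i) * f (lift ord0 i) =
   \sum_(i < n.+1) qbin_alt q n i.+1 * f i.+1 -
   \sum_(i < n.+1) qbin_alt q n i * (q ^+ n * f i.+1).
  by rewrite -sumrB; apply: eq_bigr => i _; rewrite qbin_altS; ring.
have h : \sum_(k < n.+2) qbin_alt q n k * f k =
         1 * f 0%N + \sum_(i < n.+1) qbin_alt q n i.+1 * f i.+1.
  by rewrite big_ord_recl qbin_alt0.
rewrite addrA -h big_ord_recr /= qbin_alt_gt mul0r addr0 -sumrB.
by apply: eq_bigr => i _; rewrite mulrBr.
Qed.

(** With [f] constant, each lowering from [m.+1] to [m] yields a factor [1 - q ^+ m], and the last
    one, at [m = 0], vanishes. *)
Lemma sum_qbin_alt n : \sum_(k < n.+2) qbin_alt q n.+1 k = 0.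
Proof.
have h m : \sum_(k < m.+2) qbin_alt q m.+1 k =
    (1 - q ^+ m) * \sum_(k < m.+1) qbin_alt q m k.
  have := sum_qbin_altS m (fun=> 1).
  under eq_bigr do rewrite mulr1.
  by move=> ->; rewrite mulr_sumr; apply: eq_bigr => k _; ring.
elim: n => [|n IH]; first by rewrite h expr0 subrr mul0r.
by rewrite h IH mulr0.
Qed.

(* A terminating q-Chu-Vandermonde sum, in partial-fraction form. *)
Lemma sum_qbin_alt_frac n x : 0 <= x < 1 ->
  \sum_(k < n.+1) qbin_alt q n k * (q ^+ k / (1 - x * q ^+ k)) =
  qpoch q q n / qpoch x q n.+1.
Proof.
elim: n x => [|n IH] x hx.
  by rewrite big_ord1 qbin_alt0 !qpochS !qpoch0 expr0 !mul1r.
have hxq : 0 <= x * q < 1 by have := mulr_expr_lt1 hq0 hq1 1 hx; rewrite expr1.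
rewrite (sum_qbin_altS n (fun k => q ^+ k / (1 - x * q ^+ k))).
(* Shifting [k] by one amounts to replacing [x] by [x * q], up to a power of [q]; hence the
   induction with [x] general. *)
transitivity (\sum_(k < n.+1) qbin_alt q n k * (q ^+ k / (1 - x * q ^+ k)) -
  q ^+ n.+1 * \sum_(k < n.+1)
     qbin_alt q n k * (q ^+ k / (1 - (x * q) * q ^+ k))).
  rewrite mulr_sumr -sumrB; apply: eq_bigr => k _.
  rewrite -[x * q * _]mulrA -exprS; set d := (1 - x * q ^+ k.+1)^-1.
  by rewrite !exprS; ring.
rewrite !IH // (qpochSl _ x n.+1) (qpochS _ (x * q) n) (qpochSl _ x n) qpochS.
have h1 : qpoch (x * q) q n != 0 by rewrite gt_eqF // qpoch_gt0.
have h2 := one_sub_neq0 hq0 hq1 0 hx; rewrite expr0 mulr1 in h2.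
have h3 := one_sub_neq0 hq0 hq1 n hxq.
by rewrite exprS; field; rewrite h1 h2 h3.
Qed.

End AlternatingGaussianBinomials.

(** * Coefficients of the [q]-Laguerre polynomials, and the functional L applied to them *)

Section QLaguerreMoments.
Context {R : realType} (q : R).
Hypotheses (hq0 : 0 < q) (hq1 : q < 1).
Implicit Types (alpha beta b : R) (n k : nat).

Let q_neq0 : q != 0. Proof. by rewrite gt_eqF. Qed.

Lemma powR_qD (x y : R) : q `^ (x + y) = q `^ x * q `^ y.
Proof. by rewrite powRD // q_neq0 implybT. Qed.

Lemma powR_qMn (x : R) n : q `^ (n%:R * x) = (q `^ x) ^+ n.
Proof. by rewrite mulrC powRrM powR_mulrn ?powR_ge0. Qed.

Lemma bin2_natr n : 'C(n, 2)%:R = n%:R * (n%:R - 1) / 2 :> R.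
Proof.
elim: n => [|n IH]; first by rewrite bin0n !mul0r.
by rewrite binS bin1 natrD IH -natr1; field.
Qed.

Lemma powR_bin2 n : q `^ (n%:R * (n%:R - 1) / 2) = q ^+ 'C(n, 2).
Proof. by rewrite -bin2_natr powR_mulrn // ltW. Qed.

Lemma bin2_sqr n : (n * n = 'C(n, 2) + 'C(n, 2) + n)%N.
Proof. by elim: n => // n IH; rewrite mulSn mulnS IH binS bin1; lia. Qed.

(** The value at 0, with q^(-n(n+beta)) rewritten through b = q^(beta+1) so that only natural powers
    occur. *)
Definition qLaguerre_const b n : R :=
  (-1) ^+ n * q ^+ n / (q ^+ (n * n) * b ^+ n) * qpoch b q n.

(* The coefficient of [x^k] in the polynomial with parameter [beta],
   where [b = q^(beta+1)]. *)
Definition qLaguerre_coef b n k : R :=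
  qLaguerre_const b n *
  (qbin_alt q n k * (q ^+ 'C(k, 2) * b ^+ k / qpoch b q k)).

Lemma qLaguerreE beta n :
  qLaguerre q beta n =
  \poly_(k < n.+1) qLaguerre_coef (q `^ (beta + 1)) n k.
Proof.
rewrite /qLaguerre /qLaguerre_coef; set b := q `^ (beta + 1).
have b0 : b != 0 by rewrite gt_eqF // powR_gt0.
have -> : q `^ (- (n%:R * (n%:R + beta))) = q ^+ n / (q ^+ (n * n) * b ^+ n).
  have -> : - (n%:R * (n%:R + beta)) =
      n%:R + - ((n * n)%N%:R + n%:R * (beta + 1)) by rewrite natrM; ring.
  by rewrite powR_qD powRN powR_qD powR_qMn !powR_mulrn // ltW.
have -> : q `^ (n%:R + beta + 1) = q ^+ n * b.
  by rewrite -addrA powR_qD powR_mulrn // ltW.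
rewrite poly_def scaler_sumr; apply: eq_bigr => k _.
rewrite exprZn !scalerA; congr (_ *: _).
rewrite powRN powR_mulrn ?(ltW hq0) // powR_bin2 /qbin_alt /qLaguerre_const.
by rewrite exprMn -exprM !invfM; ring.
Qed.

(** Monicity: the powers of [q] cancel by n^2 = 2 C(n,2) + n. *)
Lemma qLaguerre_coefnn b n : 0 < b < 1 -> qLaguerre_coef b n n = 1.
Proof.
case/andP=> b0 b1.
have h : qpoch b q n != 0 by rewrite gt_eqF // qpoch_gt0 // b1 ltW.
rewrite /qLaguerre_coef /qLaguerre_const qbin_altnn // bin2_sqr !exprD.
have bn : b ^+ n != 0 by rewrite expf_neq0 // gt_eqF.
have qn m : q ^+ m != 0 by rewrite expf_neq0.
have s : (-1 : R) ^+ n * (-1) ^+ n = 1 by rewrite -exprMn mulrNN mulr1 expr1n.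
transitivity ((-1 : R) ^+ n * (-1) ^+ n); last exact: s.
by field; rewrite h bn !qn.
Qed.

Lemma qLaguerre_coef0 b n : qLaguerre_coef b n 0 = qLaguerre_const b n.
Proof.
by rewrite /qLaguerre_coef qbin_alt0 qpoch0 bin0n !expr0 divr1 !mulr1.
Qed.

(** Compares the constant terms for alpha and alpha + 1: splitting (b;q)_(n+1) at its last or its
    first factor gives the two sides. *)
Lemma qLaguerre_const_shift b n : 0 < b < 1 ->
  qLaguerre_const b n * (1 - b * q ^+ n) =
  qLaguerre_const (b * q) n * (q ^+ n * (1 - b)).
Proof.
case/andP=> b0 b1; rewrite /qLaguerre_const -[LHS]mulrA -qpochS qpochSl exprMn.
have bn : b ^+ n != 0 by rewrite expf_neq0 // gt_eqF.
have qn m : q ^+ m != 0 by rewrite expf_neq0.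
by field; rewrite bn !qn.
Qed.

Definition qLaguerre_moment b n : R := qpoch b q n / (b ^+ n * q ^+ 'C(n, 2)).

(** The moment cancels every factor of the coefficient depending on [k] except [qbin_alt], leaving
    [sum_qbin_alt]. *)
Lemma qLaguerre_moment_orth b n : 0 < b < 1 ->
  \sum_(k < n.+2) qLaguerre_coef b n.+1 k * qLaguerre_moment b k = 0.
Proof.
case/andP=> b0 b1.
transitivity (qLaguerre_const b n.+1 * \sum_(k < n.+2) qbin_alt q n.+1 k).
  rewrite mulr_sumr; apply: eq_bigr => k _.
  have h : qpoch b q k != 0 by rewrite gt_eqF // qpoch_gt0 // b1 ltW.
  have bn : b ^+ k != 0 by rewrite expf_neq0 // gt_eqF.
  have qn m : q ^+ m != 0 by rewrite expf_neq0.
  rewrite /qLaguerre_coef /qLaguerre_moment; field.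
  by rewrite bn h qn.
by rewrite sum_qbin_alt // mulr0.
Qed.

(** Here the cancellation leaves q^k (b;q)_k / (bq;q)_k = (1 - b) q^k / (1 - b q^k), so
    [sum_qbin_alt_frac] applies at [x = b]. *)
Lemma qLaguerre_moment_shift b n : 0 < b < 1 ->
  \sum_(k < n.+1) qLaguerre_coef (b * q) n k * qLaguerre_moment b k =
  qLaguerre_const (b * q) n * (qpoch q q n / qpoch (b * q) q n).
Proof.
case/andP=> b0 b1; have hb : 0 <= b < 1 by rewrite b1 ltW.
have hbq : 0 <= b * q < 1 by have := mulr_expr_lt1 hq0 hq1 1 hb; rewrite expr1.
have h0 := one_sub_neq0 hq0 hq1 0 hb; rewrite expr0 mulr1 in h0.
transitivity (qLaguerre_const (b * q) n * ((1 - b) *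
    \sum_(k < n.+1) qbin_alt q n k * (q ^+ k / (1 - b * q ^+ k)))).
  rewrite !mulr_sumr; apply: eq_bigr => k _.
  rewrite /qLaguerre_coef /qLaguerre_moment.
  have h1 : qpoch (b * q) q k != 0 by rewrite gt_eqF // qpoch_gt0.
  have h2 := one_sub_neq0 hq0 hq1 k hb.
  have -> : qpoch b q k = (1 - b) * qpoch (b * q) q k / (1 - b * q ^+ k).
    by rewrite -qpochSl qpochS mulfK.
  have bn : b ^+ k != 0 by rewrite expf_neq0 // gt_eqF.
  have qn m : q ^+ m != 0 by rewrite expf_neq0.
  rewrite exprMn; field.
  by rewrite bn h1 h2 qn.
rewrite sum_qbin_alt_frac // qpochSl; congr (_ * _); field.
by rewrite h0 gt_eqF // qpoch_gt0.
Qed.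

End QLaguerreMoments.

(** * The quotients gamma(n, alpha+1; q) and the coefficients r_n *)

Section QGamma.
Context {R : realType} (q alpha : R).
Hypotheses (hq0 : 0 < q) (hq1 : q < 1) (halpha : -1 < alpha).
Implicit Types n : nat.

Let a := q `^ (alpha + 1).
Let g n := qgamma n%:R (alpha + 1) q.

Lemma powR_q_itv : 0 < a < 1.
Proof.
have e : 1 `^ (alpha + 1) = 1 :> R by rewrite powR1.
rewrite /a powR_gt0 //= -[ltRHS]e gt0_ltr_powR //.
- by rewrite -ltrBlDr sub0r.
- by rewrite nnegrE ltW.
- by rewrite nnegrE.
Qed.

Let hqn n : 0 <= q ^+ n <= 1.
Proof.
by have := mulr_expr_le1 hq0 hq1 n (x := 1); rewrite mul1r ler01 lexx => ->.
Qed.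

Let hqSn n : 0 <= q ^+ n.+1 < 1.
Proof. by rewrite exprn_ge0 ?(ltW hq0) //= exprn_ilt1 // ltW. Qed.

Let haqn n : 0 <= a * q ^+ n < 1.
Proof.
by case/andP: powR_q_itv => a0 a1; apply: mulr_expr_lt1; rewrite // a1 ltW.
Qed.

Lemma qgamma_natE n : g n = qpoch_inf (q ^+ n) q / qpoch_inf (a * q ^+ n) q.
Proof. by rewrite /g /qgamma powR_qD // powR_mulrn ?(ltW hq0) // [_ * a]mulrC. Qed.

Lemma qgamma0 : g 0 = 0.
Proof.
rewrite qgamma_natE (qpoch_infD hq0 hq1 1 (hqn 0)).
by rewrite qpochS !expr0 mulr1 subrr mulr0 !mul0r.
Qed.

Lemma qgamma_gt0 n : 0 < g n.+1.
Proof. by rewrite qgamma_natE divr_gt0 // qpoch_inf_gt0. Qed.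

(** Strict monotonicity of the infinite product, as [a * q ^+ n < q ^+ n]. It makes the denominators
    of all r_n, and r_0 itself, nonzero. *)
Lemma qgamma_lt1 n : g n < 1.
Proof.
have /andP[a0 a1] := powR_q_itv; have /andP[h0 h1] := haqn n.
have /andP[_ hn] := hqn n.
rewrite qgamma_natE ltr_pdivrMr ?qpoch_inf_gt0 // mul1r.
by apply: lt_qpoch_inf => //; rewrite gtr_pMl // exprn_gt0.
Qed.

Lemma qgammaS n : g n.+2 * (1 - q ^+ n.+1) = g n.+1 * (1 - a * q ^+ n.+1).
Proof.
have hle (x : R) : 0 <= x < 1 -> 0 <= x <= 1 by move=> /andP[-> /ltW ->].
rewrite !qgamma_natE (qpoch_infD hq0 hq1 1 (hqn n.+1)).
rewrite (qpoch_infD hq0 hq1 1 (hle _ (haqn n.+1))).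
rewrite !qpochS !qpoch0 !mul1r expr0 !mulr1 expr1 -[_ * _ * q]mulrA -!exprSr.
have h1 := qpoch_inf_gt0 hq0 hq1 (haqn n.+2).
have h2 : 1 - a * q ^+ n.+1 != 0.
  by have /andP[_ h] := haqn n.+1; rewrite subr_eq0 gt_eqF.
by field; rewrite h2 gt_eqF.
Qed.

(** Iterating [qgammaS] turns the Chu-Vandermonde value (q;q)_n / (aq;q)_n into gamma(1) /
    gamma(n+1). *)
Lemma qgamma1E n : g 1 * qpoch (a * q) q n = g n.+1 * qpoch q q n.
Proof.
elim: n => [|n IH]; first by rewrite !qpoch0.
rewrite !qpochS mulrA IH -[a * q * _]mulrA -!exprS mulrAC -qgammaS.
by rewrite mulrAC mulrA.
Qed.

Lemma rcoef0E : rcoef q alpha 0 = 1 - g 1.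
Proof. by rewrite /rcoef -/(g 0) -/(g 1) qgamma0 subr0 divr1. Qed.

Lemma rcoef0_neq0 : rcoef q alpha 0 != 0.
Proof. by rewrite rcoef0E subr_eq0 gt_eqF // qgamma_lt1. Qed.

(** The left side is L + (r_0 - 1) ev_0 at the modified polynomial of degree [n.+1], divided by the
    constant term of p'_(n+1). *)
Lemma rcoef_identity n :
  (1 - rcoef q alpha n.+1) * (qpoch q q n.+1 / qpoch (a * q) q n.+1) +
  (rcoef q alpha 0 - 1) *
    (rcoef q alpha n.+1 * (q ^+ n.+1 * (1 - a) / (1 - a * q ^+ n.+1)) +
     (1 - rcoef q alpha n.+1)) = 0.
Proof.
have /andP[a0 a1] := powR_q_itv.
have haq : 0 <= a * q < 1 by have := haqn 1; rewrite expr1.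
have pq : qpoch (a * q) q n.+1 != 0 by rewrite gt_eqF // qpoch_gt0.
have h2 : 1 - a * q ^+ n.+1 != 0.
  by have /andP[_ h] := haqn n.+1; rewrite subr_eq0 gt_eqF.
have h3 : 1 - q ^+ n.+1 != 0.
  by have /andP[_ h] := hqSn n; rewrite subr_eq0 gt_eqF.
have gn2 : g n.+2 != 0 by rewrite gt_eqF // qgamma_gt0.
have gn1 : 1 - g n.+1 != 0 by rewrite subr_eq0 gt_eqF // qgamma_lt1.
have -> : qpoch q q n.+1 / qpoch (a * q) q n.+1 = g 1 / g n.+2.
  by apply/eqP; rewrite eqr_div // mulrC -qgamma1E.
rewrite rcoef0E /rcoef -/(g n.+1) -/(g n.+2).
(* Eliminating [g n.+1] leaves a rational identity in [g 1], [G], [Q] and [a]. *)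
have e : g n.+1 = g n.+2 * (1 - q ^+ n.+1) / (1 - a * q ^+ n.+1).
  by rewrite qgammaS mulfK.
move: gn1; rewrite e; set G := g n.+2; set Q := q ^+ n.+1 in h2 h3 *.
move=> gn1.
have gn1' : 1 - a * Q - G * (1 - Q) != 0.
  apply: contra_neq gn1 => h; apply: (mulIf h2).
  by rewrite mulrBl divfK // mul1r mul0r.
by field; rewrite gn2 h2 gn1'.
Qed.

End QGamma.

(** * Candidate moments of the modified polynomials, and uniqueness *)

Lemma linear_poly {R : realType} (L : {scalar {poly R}}) n (E : nat -> R) :
  L (\poly_(k < n) E k) = \sum_(k < n) E k * L 'X^k.
Proof.
by rewrite poly_def linear_sum; apply: eq_bigr => k _; rewrite linearZ.
Qed.

(** The weights are the moments of (L + (r_0 - 1) ev_0) / r_0; the case [k = 0] is separate since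
    ev_0 sees only the constant term. *)
Lemma modified_moment_orth (R : realType) (q alpha : R) n :
  0 < q -> q < 1 -> -1 < alpha ->
  let a := q `^ (alpha + 1) in let r := rcoef q alpha in
  \sum_(k < n.+2) (r n.+1 * qLaguerre_coef q a n.+1 k +
      (1 - r n.+1) * qLaguerre_coef q (a * q) n.+1 k) *
    (if k == 0%N :> nat then 1 else qLaguerre_moment q a k / r 0%N) = 0.
Proof.
move=> hq0 hq1 halpha a r.
have ha : 0 < a < 1 by apply: powR_q_itv.
have r0 : r 0%N != 0 by apply: rcoef0_neq0.
pose c k :=
  r n.+1 * qLaguerre_coef q a n.+1 k +
  (1 - r n.+1) * qLaguerre_coef q (a * q) n.+1 k.
rewrite -[LHS]/(\sum_(k < n.+2) c k *
  (if k == 0%N :> nat then 1 else qLaguerre_moment q a k / r 0%N)).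
have cE : \sum_(k < n.+2) c k * qLaguerre_moment q a k =
    (1 - r n.+1) * (qLaguerre_const q (a * q) n.+1 *
      (qpoch q q n.+1 / qpoch (a * q) q n.+1)).
  rewrite -qLaguerre_moment_shift //.
  rewrite -[RHS]add0r -[X in X + _](mulr0 (r n.+1)).
  rewrite -[X in _ * X + _](qLaguerre_moment_orth hq0 hq1 n ha).
  rewrite !mulr_sumr -big_split /=; apply: eq_bigr => k _.
  by rewrite /c; ring.
apply: (mulfI r0); rewrite mulr0.
transitivity (\sum_(k < n.+2) c k * qLaguerre_moment q a k + (r 0%N - 1) * c 0%N).
  have M0 : qLaguerre_moment q a 0 = 1.
    by rewrite /qLaguerre_moment qpoch0 bin0n !expr0 mulr1 divr1.
  rewrite [in LHS]big_ord_recl [in RHS]big_ord_recl /= M0 mulrDr !mulr1.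
  rewrite [LHS]addrC [c 0%N + _]addrC -addrA; congr (_ + _); last by ring.
  rewrite mulr_sumr; apply: eq_bigr => k _.
  by rewrite mulrCA [r 0%N * _]mulrC divfK.
rewrite cE /c !qLaguerre_coef0 //.
have h2 : 1 - a * q ^+ n.+1 != 0.
  by case/andP: ha => a0 a1; apply: one_sub_neq0 => //; rewrite a1 ltW.
(* Both constant terms become multiples of that of p'_(n+1), which then factors out and leaves
   [rcoef_identity]. *)
have -> : qLaguerre_const q a n.+1 =
    qLaguerre_const q (a * q) n.+1 * (q ^+ n.+1 * (1 - a) / (1 - a * q ^+ n.+1)).
  by apply: (mulIf h2); rewrite qLaguerre_const_shift // -[RHS]mulrA divfK.
have := rcoef_identity hq0 hq1 halpha n; rewrite -/a -/r.
set S := _ / _; set T := _ / _ => e.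
rewrite -[RHS](mulr0 (qLaguerre_const q (a * q) n.+1)) -e; ring.
Qed.

Theorem proposition5p6 (R : realType) (q alpha : R)
    (hq0 : 0 < q) (hq1 : q < 1) (halpha : -1 < alpha)
    (Lambda : {scalar {poly R}})
    (hLambda : is_moment_functional (modified_qLaguerre q alpha) Lambda) :
  moment Lambda 0 = 1 /\
  forall n : nat, (1 <= n)%N ->
    moment Lambda n =
      q `^ (- alpha * n%:R - (n%:R + 1) * n%:R / 2)
      * (qpoch (q `^ (alpha + 1)) q n / rcoef q alpha 0).
Proof.
case: hLambda => L1 Lorth.
pose a := q `^ (alpha + 1); pose r := rcoef q alpha.
have ha : 0 < a < 1 by apply: powR_q_itv.
have haq : 0 < a * q < 1.
  by case/andP: ha => a0 a1; rewrite mulr_gt0 //= mulr_ilt1 // ltW.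
have aqE : q `^ (alpha + 1 + 1) = a * q by rewrite powR_qD // powRr1 // ltW.
pose c n k :=
  r n * qLaguerre_coef q a n k + (1 - r n) * qLaguerre_coef q (a * q) n k.
have cnn n : c n n = 1 by rewrite /c !qLaguerre_coefnn //; ring.
have PE n : modified_qLaguerre q alpha n = \poly_(k < n.+1) c n k.
  rewrite /modified_qLaguerre !qLaguerreE // aqE !poly_def !scaler_sumr.
  by rewrite -big_split /=; apply: eq_bigr => k _; rewrite !scalerA -scalerDl.
have P0 : modified_qLaguerre q alpha 0 = 1.
  by rewrite PE poly_def big_ord1 cnn scale1r expr0.
(* Orthogonality is applied against the polynomial of degree 0, which is 1. *)
have sumL n : \sum_(k < n.+2) c n.+1 k * Lambda 'X^k = 0.
  by rewrite -linear_poly -PE -[modified_qLaguerre _ _ _]mul1r -P0 Lorth.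
pose M n := if n == 0%N then 1 else qLaguerre_moment q a n / r 0%N.
have M0 : M 0%N = 1 by [].
have MS n : M n.+1 = qLaguerre_moment q a n.+1 / r 0%N by [].
have sumM n : \sum_(k < n.+2) c n.+1 k * M k = 0 by apply: modified_moment_orth.
clearbody c M.
(* As [c n n = 1], each vanishing sum determines the top moment from the lower ones, so both
   sequences agree. *)
have LM n : Lambda 'X^n = M n.
  elim/ltn_ind: n => -[|n] IH; first by rewrite expr0 L1.
  have := etrans (sumM n) (esym (sumL n)).
  rewrite [LHS]big_ord_recr [RHS]big_ord_recr /= cnn !mul1r.
  have -> : \sum_(i < n.+1) c n.+1 i * M i =
            \sum_(i < n.+1) c n.+1 i * Lambda 'X^i.
    by apply: eq_bigr => i _; rewrite IH.
  by move/addrI.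
split; first by rewrite /moment LM M0.
case=> // n _; rewrite /moment LM MS /qLaguerre_moment.
have -> : - alpha * n.+1%:R - (n.+1%:R + 1) * n.+1%:R / 2 =
  - (n.+1%:R * (alpha + 1) + n.+1%:R * (n.+1%:R - 1) / 2) :> R by field.
by rewrite powRN (powR_qD hq0 (n.+1%:R * _)) powR_qMn powR_bin2 // [RHS]mulrC [RHS]mulrAC.
Qed.
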